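(* Let $G$ be a graph with at least one edge and $k\ge 1$. Then $G$ admits a $k$-super graceful labeling in which all edge labels are odd if and only if $k=1$ and $G$ is a star $K(1,q)$ for some $q\ge 1$.
   Context: All graphs are simple, finite, undirected and without isolated vertices. For integers $a\le b$, $[a,b]$ is the set of integers between $a$ and $b$ inclusive. For $k\ge 1$, a $k$-super graceful labeling of a graph $G=(V,E)$ with $p$ vertices and $q$ edges is a bijection $f:V\cup E\to[k,k+p+q-1]$ with $f(uv)=|f(u)-f(v)|$ for every edge $uv$. $K(1,q)$ is the star with $q$ edges. *)

(* Defs.v *)
From HB Require Import structures.
From mathcomp Require Import all_boot all_order all_algebra.

Set Implicit Arguments.
Unset Strict Implicit.
Unset Printing Implicit Defensive.

Export ssrint.IntDist.

Record sgraph := SGraph {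
  vertex :> finType;
  adj : rel vertex;
  adj_sym : symmetric adj;
  adj_irr : irreflexive adj
}.

Definition no_isolated (G : sgraph) : Prop :=
  forall x : G, exists y : G, adj x y.

Definition edges (G : sgraph) : {set {set G}} :=
  [set [set x; y] | x in G, y in G & adj x y].

Definition edge (G : sgraph) : Type := {A : {set G} | A \in edges G}.

Definition isomorphic (G H : sgraph) : Prop :=
  exists2 h : G -> H, bijective h & forall x y : G, adj (h x) (h y) = adj x y.

Definition bip_rel (m n : nat) : rel ('I_m + 'I_n) :=
  fun u v => match u, v with
             | inl _, inr _ | inr _, inl _ => true
             | _, _ => false
             end.

Lemma bip_rel_sym m n : symmetric (@bip_rel m n).
Proof. by move=> [?|?] [?|?]. Qed.

Lemma bip_rel_irr m n : irreflexive (@bip_rel m n).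
Proof. by move=> [?|?]. Qed.

(* The complete bipartite graph K(m, n). *)
Definition complete_bipartite (m n : nat) : sgraph :=
  SGraph (@bip_rel_sym m n) (@bip_rel_irr m n).

Definition star (q : nat) : sgraph := complete_bipartite 1 q.

(* A function on V ∪ E is a function on the disjoint sum of the two types;
   the first two clauses say that f is a bijection onto the integer interval
   [k, k + p + q - 1]. *)
Definition super_graceful (k : nat) (G : sgraph) (f : G + edge G -> nat) : Prop :=
  [/\ injective f,
      forall n : nat,
        k <= n <= k + #|G| + #|edges G| - 1 <-> exists z, f z = n
    & forall (a : edge G) (u v : G), val a = [set u; v] ->
        f (inr a) = `|f (inl u) - f (inl v)|%N ].

(* Main.v *)
Require Import Defs.
From HB Require Import structures.
From mathcomp Require Import all_boot all_order all_algebra.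
From mathcomp Require Import zify.

Set Implicit Arguments.
Unset Strict Implicit.
Unset Printing Implicit Defensive.

(** If all edge labels are odd, every edge joins an even vertex to an odd one,
    and every even label sits on a vertex.  The labels fill an interval, so the
    map [n |-> n - 1] shows that odd labels outnumber even ones by at most one;
    as the even vertices have distinct incident edges, there are at least as
    many edges as even vertices.  Hence there is exactly one odd vertex [c],
    [G] is a star centred at [c], and [k] is odd.  The largest label is odd and
    not an edge label, so it belongs to [c]; the label just below it belongs to
    a leaf, whose edge then has label 1, so [k = 1].  Conversely label the
    centre of [K(1, q)] by [2 q + 1] and the leaves by [2, 4, ..., 2 q]. *)

(** * Edges as two-element vertex sets, and counting in the disjoint sum of vertices and edges *)

Lemma set2_eq (T : finType) (u v x y : T) :
  [set u; v] = [set x; y] -> u = x /\ v = y \/ u = y /\ v = x.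
Proof.
move=> /setP E.
have := E u; have := E v; have := E x; have := E y.
rewrite !inE !eqxx ?orbT /= (eq_sym x u) (eq_sym x v) (eq_sym y u) (eq_sym y v).
case: (u =P x) => ?; case: (v =P y) => ?; case: (u =P y) => ?; case: (v =P x) => ? //=;
  by [left | right].
Qed.

Section Edges.
Variable G : sgraph.
Implicit Types u v : G.

Lemma edgesP (A : {set G}) :
  reflect (exists u v, adj u v /\ A = [set u; v]) (A \in edges G).
Proof.
apply: (iffP imset2P) => [[u v _]|[u [v [uv ->]]]].
  by rewrite inE => /andP[_ uv] ->; exists u, v.
by exists u v; rewrite // inE uv andbT.
Qed.

Lemma mem_edges u v : ([set u; v] \in edges G) = adj u v.
Proof.
apply/edgesP/idP => [[x [y [xy /set2_eq]]]|uv]; last by exists u, v.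
by case=> [[-> ->]|[-> ->]] //; rewrite adj_sym.
Qed.

Lemma adj_edge u v : adj u v -> exists a : edge G, val a = [set u; v].
Proof. by rewrite -mem_edges => uv; exists (exist (fun A => A \in edges G) _ uv). Qed.

Lemma edge_adj (a : edge G) : exists u v, adj u v /\ val a = [set u; v].
Proof. exact/edgesP/(valP a). Qed.

(** With [P] the odd vertices this counts the odd labels, since every edge label is odd; the next
    lemma counts the even ones. *)
Lemma card_vertices_edges (P : pred G) :
  #|[set z : G + edge G | if z is inl v then P v else true]|
  = #|[set v | P v]| + #|edges G|.
Proof.
rewrite -[LHS]sum1dep_card big_sumType /= sum1dep_card sum1_card; congr (_ + _).
by rewrite card_sig; apply: eq_card.
Qed.

Lemma card_vertices (P : pred G) :
  #|[set z : G + edge G | if z is inl v then P v else false]| = #|[set v | P v]|.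
Proof.
rewrite -[LHS]sum1dep_card big_sumType /= sum1dep_card big_pred0 ?addn0 //.
Qed.

End Edges.

(** * Consequences of all edge labels being odd *)

Section OddEdges.
Variables (G : sgraph) (k : nat) (f : G + edge G -> nat).
Hypothesis hG : no_isolated G.
Hypothesis hE : exists x y : G, adj x y.
Hypothesis f_sg : super_graceful k f.
Hypothesis f_odd : forall a : edge G, odd (f (inr a)).

Local Notation even_vertices := [set v : G | ~~ odd (f (inl v))].
Local Notation odd_vertices := [set v : G | odd (f (inl v))].

Let f_inj : injective f. Proof. by case: f_sg. Qed.

Lemma label_bounds z : k <= f z <= k + #|G| + #|edges G| - 1.
Proof. by case: f_sg => _ /(_ (f z)) [_ H] _; apply: H; exists z. Qed.

Lemma label_onto n : k <= n <= k + #|G| + #|edges G| - 1 -> exists z, f z = n.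
Proof. by case: f_sg => _ /(_ n) [H _] _. Qed.

Lemma edge_label (a : edge G) (u v : G) : val a = [set u; v] ->
  f (inr a) = `|f (inl u) - f (inl v)|%N.
Proof. by case: f_sg => _ _ /(_ a u v). Qed.

Lemma adj_parity (u v : G) : adj u v -> odd (f (inl u)) = ~~ odd (f (inl v)).
Proof.
move=> /adj_edge[a /edge_label]; move: (f_odd a); move: (f _) (f _) (f _); lia.
Qed.

(** Each even vertex picks one incident edge; an edge has only one even end, so no edge is picked
    twice. *)
Lemma card_even_vertices : #|even_vertices| <= #|edges G|.
Proof.
have /fin_all_exists[g gP] : forall v : G, exists w : G, adj v w by exact: hG.
have inj : {in even_vertices &, injective (fun v => [set v; g v])}.
  move=> u v; rewrite !inE => eu ev /set2_eq[[]//|[uE _]].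
  by move: eu ev; rewrite uE -(adj_parity (gP v)) => ->.
rewrite -(card_in_imset inj) subset_leq_card //.
by apply/subsetP => A /imsetP[v _ ->]; rewrite mem_edges.
Qed.

(** Every odd label above [k] has an even predecessor in the interval. The term [odd k] pays for [k]
    itself, whose predecessor falls outside. *)
Lemma card_odd_labels :
  #|odd_vertices| + #|edges G| <= odd k + #|even_vertices|.
Proof.
pose O := [set z | odd (f z)].
have cO : #|O| = #|odd_vertices| + #|edges G|.
  rewrite -card_vertices_edges; apply: eq_card => -[v|a]; rewrite !inE //.
  by rewrite f_odd.
have cE : #|[set z | ~~ odd (f z)]| = #|even_vertices|.
  rewrite -card_vertices; apply: eq_card => -[v|a]; rewrite !inE //.
  by rewrite f_odd.
have [z0 z0k] : exists z, f z = k.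
  by case: hE => x _; have := label_bounds (inl x); move=> H; apply: label_onto; lia.
(* [h] passes to the element whose label is one smaller; at [z0] its value is unconstrained. *)
have /fin_all_exists[h hP] : forall z, exists z', k < f z -> f z' = (f z).-1.
  move=> z; have := label_bounds z; case: (ltnP k (f z)) => [kz b|_ _]; last by exists z.
  by have [|z' z'E] := @label_onto (f z).-1; [lia | exists z'].
have gtk z : z \in O :\ z0 -> k < f z.
  rewrite !inE => /andP[zz0 _]; have := label_bounds z.
  have : f z != f z0 by rewrite (inj_eq f_inj).
  rewrite z0k; lia.
have inj : {in O :\ z0 &, injective h}.
  move=> y z /gtk ky /gtk kz /(congr1 f); rewrite !hP // => e.
  by apply: f_inj; lia.
rewrite -cO -cE (cardsD1 z0) inE z0k leq_add2l -(card_in_imset inj).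
apply/subset_leq_card/subsetP => _ /imsetP[z zO ->].
have := gtk _ zO; move: zO; rewrite !inE => /andP[_ oz] kz; rewrite hP //; lia.
Qed.

(** Any edge has an odd end, and the two counts bound the number of odd vertices by [odd k]. *)
Lemma odd_vertices_card1 : #|odd_vertices| = 1.
Proof.
have : 0 < #|odd_vertices|.
  case: hE => x [y /adj_parity xy]; apply/card_gt0P.
  have [ox|ex] := boolP (odd (f (inl x))); [exists x | exists y]; rewrite inE //.
  by rewrite -[odd _]negbK -xy.
by have := card_odd_labels; have := card_even_vertices; case: (odd k); lia.
Qed.

(** An edge has exactly one odd end, which must be [c]. Conversely, an even vertex is not isolated,
    and its neighbour is odd, hence [c]. The exclusive or expresses a star centred at [c]. *)
Lemma odd_vertex_adj (c : G) : odd_vertices = [set c] ->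
  forall u v, adj u v = (u == c) (+) (v == c).
Proof.
move=> cE; have oE u : odd (f (inl u)) = (u == c).
  by have /setP/(_ u) := cE; rewrite !inE.
move=> u v; apply/idP/idP => [/adj_parity|]; first by rewrite !oE => ->; case: (_ == _).
wlog: u v / u == c => [H|/eqP-> ].
  have := H u v; have := H v u; rewrite (adj_sym v u).
  by case: (u == c); case: (v == c) => //= Hvu Huv _; [exact: Huv | exact: Hvu].
rewrite eqxx addTb => vc; have [w vw] := hG v.
by move: (adj_parity vw); rewrite !oE (negbTE vc) adj_sym; case: eqP => // <-.
Qed.

Lemma label_start : 1 <= k -> k = 1.
Proof.
move=> hk; have cO := odd_vertices_card1.
have /eqP/cards1P[c cE] := cO.
have cG : #|G| = 1 + #|even_vertices|.
  rewrite -cO -(cardC [in odd_vertices]); congr (_ + _).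
  by apply: eq_card => v; rewrite !inE.
have H1 := card_odd_labels; have H2 := card_even_vertices.
have oc : odd (f (inl c)) by have /setP/(_ c) := cE; rewrite !inE eqxx.
have q0 : 0 < #|edges G|.
  by case: hE => x [y xy]; apply/card_gt0P; exists [set x; y]; rewrite mem_edges.
(* With one odd vertex both counts are tight, so there are as many even vertices as edges, say [q],
   and the top label is [k + 2 q], which is odd. *)
have ok : odd k by lia.
have [|z zM] := @label_onto (k + #|G| + #|edges G| - 1); first by lia.
(* An edge label is a difference of labels that are at least [k >= 1], so it stays below the top
   label. *)
have fc : f (inl c) = k + #|G| + #|edges G| - 1.
  case: z zM => [v vM|a aM].
    have : v \in odd_vertices by rewrite inE vM; lia.
    by rewrite cE inE => /eqP <-.
  have [u [v [_ /edge_label]]] := edge_adj a.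
  have := label_bounds (inl u); have := label_bounds (inl v); rewrite aM; lia.
have [|[v|a] zE] := @label_onto (k + #|G| + #|edges G| - 2); first by lia.
  have vc : v == c = false by apply/eqP => vc; move: zE; rewrite vc fc; lia.
  have /adj_edge[a aE] : adj c v by rewrite (odd_vertex_adj cE) eqxx vc.
  have := label_bounds (inr a); rewrite (edge_label aE) fc zE; lia.
by have := f_odd a; rewrite zE; lia.
Qed.

End OddEdges.

(** * Recognising a star from its centre *)

Lemma star_of_center (G : sgraph) (c : G) :
  (forall u v, adj u v = (u == c) (+) (v == c)) ->
  isomorphic G (star #|[set~ c]|).
Proof.
move=> cP; pose L := [set~ c].
(* [insub] fails exactly at [c]; elsewhere it supplies the membership proof that [enum_rank_in] asks
   for. *)
pose h (u : G) : star #|L| :=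
  match insub u : option {x | x \in L} with
  | Some x => inr (enum_rank_in (valP x) u)
  | None => inl ord0
  end.
pose g (s : star #|L|) : G := if s is inr i then enum_val i else c.
have hc : h c = inl ord0 by rewrite /h insubF // !inE eqxx.
have hl u : u != c -> exists2 i, h u = inr i & enum_val i = u.
  move=> uc; have uL : u \in L by rewrite !inE.
  rewrite /h; case: insubP => [x _ xu|]; last by rewrite uL.
  by eexists; [reflexivity | rewrite enum_rankK_in].
exists h.
  exists g => [u|[j|i]].
  - by have [->|/hl[i -> <-]//] := eqVneq u c; rewrite hc.
  - by rewrite /= hc; congr inl; apply/val_inj; case: j => -[].
  - have /hl[j /= -> /enum_val_inj -> //] : enum_val i != c.
    by have := enum_valP i; rewrite !inE.
move=> u v; rewrite cP.
have [->|uc] := eqVneq u c; have [->|vc] := eqVneq v c; rewrite ?hc //=.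
- by have [i ->] := hl _ vc.
- by have [i ->] := hl _ uc.
- by have [i ->] := hl _ uc; have [j ->] := hl _ vc.
Qed.

(** * The labeling of a star, pulled back along an isomorphism *)

Section StarLabeling.
Variables (G : sgraph) (q : nat) (h : G -> star q).
Hypothesis h_bij : bijective h.
Hypothesis h_adj : forall x y : G, adj (h x) (h y) = adj x y.

Definition leaf_label (v : G) : nat :=
  if h v is inr i then (i.+1).*2 else 0.

(* The centre contributes 0 to the sum, so an edge gets [2 q + 1] minus the
   label of its leaf. *)
Definition star_label (z : G + edge G) : nat :=
  match z with
  | inl v => if h v is inr i then (i.+1).*2 else q.*2.+1
  | inr a => q.*2.+1 - \sum_(v in val a) leaf_label v
  end.

Lemma star_edgeP (a : edge G) :
  exists (u v : G) (o : 'I_1) (i : 'I_q),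
    [/\ h u = inl o, h v = inr i & val a = [set u; v]].
Proof.
have [u [v [uv aE]]] := edge_adj a; move: uv; rewrite -h_adj.
case hu: (h u) => [o|i]; case hv: (h v) => [o'|i'] //= _.
  by exists u, v, o, i'.
by exists v, u, o', i; rewrite setUC.
Qed.

Lemma star_edge_label (a : edge G) u v o i :
  h u = inl o -> h v = inr i -> val a = [set u; v] ->
  star_label (inr a) = q.*2.+1 - (i.+1).*2.
Proof.
move=> hu hv aE; rewrite /= aE big_setU1 ?big_set1 /=.
  by rewrite /leaf_label hu hv.
by rewrite inE; apply/eqP => uv; move: hv; rewrite -uv hu.
Qed.

Lemma card_star : #|G| = q.+1.
Proof. by rewrite (bij_eq_card h_bij) card_sum !card_ord. Qed.

Lemma card_edges_star : #|edges G| = q.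
Proof.
have [g hK gK] := h_bij.
(* Edges are counted by their leaves: leaf [i] gives the edge to the centre. *)
have inj : injective (fun i : 'I_q => [set g (inl ord0); g (inr i)]).
  move=> i j /set2_eq[[_ /(can_inj gK)[]//]|[/(can_inj gK)//]].
rewrite -[RHS]card_ord -(card_imset _ inj); apply: eq_card => A.
apply/idP/imsetP => [AE|[i _ ->]]; last by rewrite mem_edges -h_adj !gK.
have [u [v [o [i [hu hv /= ->]]]]] := star_edgeP (exist (fun A => A \in edges G) A AE).
exists i; rewrite // -(hK u) -(hK v) hu hv; congr [set g (inl _); _].
exact: ord1.
Qed.

(** Leaves have even labels, edges odd labels at most [2 q - 1], and the centre [2 q + 1]. So a
    collision is within one kind, where the label determines the leaf. *)
Lemma star_label_inj : injective star_label.
Proof.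
have [g hK gK] := h_bij.
have hI := bij_inj h_bij.
move=> [x|a] [y|b].
- rewrite /=; case hx: (h x) => [o|i]; case hy: (h y) => [o'|j] => e; try lia.
    by congr inl; apply: hI; rewrite hx hy !ord1.
  by congr inl; apply: hI; rewrite hx hy; congr inr; apply: val_inj => /=; lia.
- have [u [v [o [i [hu hv bE]]]]] := star_edgeP b.
  rewrite (star_edge_label hu hv bE) /=; have := ltn_ord i.
  by case: (h x) => [?|j]; lia.
- have [u [v [o [i [hu hv aE]]]]] := star_edgeP a.
  rewrite (star_edge_label hu hv aE) /=; have := ltn_ord i.
  by case: (h y) => [?|j]; lia.
- have [u [v [o [i [hu hv aE]]]]] := star_edgeP a.
  have [u' [v' [o' [i' [hu' hv' bE]]]]] := star_edgeP b.
  rewrite (star_edge_label hu hv aE) (star_edge_label hu' hv' bE) => e.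
  have ii : i = i' by apply: val_inj => /=; have := ltn_ord i; have := ltn_ord i'; lia.
  congr inr; apply: val_inj; rewrite aE bE.
  by rewrite -(hK u) -(hK v) -(hK u') -(hK v') hu hv hu' hv' ii !ord1.
Qed.

Lemma star_label_odd (a : edge G) : odd (star_label (inr a)).
Proof.
have [u [v [o [i [hu hv aE]]]]] := star_edgeP a.
rewrite (star_edge_label hu hv aE); have := ltn_ord i; lia.
Qed.

Lemma star_label_super_graceful : super_graceful 1 star_label.
Proof.
have [g hK gK] := h_bij; split; first exact: star_label_inj.
- move=> n; rewrite card_star card_edges_star; split=> [n_le|[[v|a] <-]].
  + have [->|nq] := eqVneq n q.*2.+1.
      by exists (inl (g (inl ord0))); rewrite /= gK.
    have [on|en] := boolP (odd n).
      (* Solves [2 q + 1 - 2 (i + 1) = n] for the leaf index [i]; the even case below solves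
         [2 (i + 1) = n]. *)
      have iq : q - n./2.+1 < q by lia.
      have /adj_edge[a aE] : adj (g (inl ord0)) (g (inr (Ordinal iq))).
        by rewrite -h_adj !gK.
      exists (inr a); rewrite (star_edge_label (gK _) (gK _) aE) /=; lia.
    have iq : n./2.-1 < q by lia.
    by exists (inl (g (inr (Ordinal iq)))); rewrite /= gK /=; lia.
  + rewrite /=; case: (h v) => [_|i]; first lia.
    by have := ltn_ord i; lia.
  + have [u [v [o [i [hu hv aE]]]]] := star_edgeP a.
    rewrite (star_edge_label hu hv aE); have := ltn_ord i; lia.
- move=> a x y.
  have [u [v [o [i [hu hv aE]]]]] := star_edgeP a.
  rewrite (star_edge_label hu hv aE) aE; have := ltn_ord i.
  by move=> iq /set2_eq[[<- <-]|[<- <-]]; rewrite /= hu hv; lia.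
Qed.

End StarLabeling.

Theorem theorem4p2 (G : sgraph) (k : nat)
    (hG : no_isolated G) (hE : exists x y : G, adj x y) (hk : 1 <= k) :
  (exists f : G + edge G -> nat,
      super_graceful k f /\ forall a : edge G, odd (f (inr a)))
  <-> (k = 1 /\ exists2 q : nat, 1 <= q & isomorphic G (star q)).
Proof.
split=> [[f [f_sg f_odd]]|[-> [q _ [h h_bij h_adj]]]]; last first.
  exists (star_label h); split; first exact: star_label_super_graceful.
  exact: star_label_odd.
split; first exact: (label_start hG hE f_sg f_odd hk).
have /eqP/cards1P[c cE] := odd_vertices_card1 hG hE f_sg f_odd.
have cP := odd_vertex_adj hG f_sg f_odd cE.
exists #|[set~ c]|; last exact: star_of_center.
(* One end of any edge differs from [c], so there is at least one leaf. *)
case: hE => x [y]; rewrite cP => xy; apply/card_gt0P.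
by have [xc|xc] := eqVneq x c; [exists y | exists x]; rewrite !inE //;
  move: xy; rewrite xc eqxx.
Qed.
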